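(* Let $X$ be an infinite regular cardinal. For $n\geq 2$ let $\mathcal M_n=\langle\{m^n_2\}\cup T_1\rangle$. The sequence $(\mathcal M_n)_{n\geq 2}$ forms a countably infinite (strictly) descending chain: $$\mathcal O=\mathcal M_2\supsetneq\mathcal M_3=\mathrm{Pol}(T_1)\supsetneq\mathcal M_4\supsetneq\cdots\supsetneq\mathcal M_n\supsetneq\mathcal M_{n+1}\supsetneq\cdots$$ Moreover, $\bigcap_{n\geq 2}\mathcal M_n=\mathcal U$.
   Context: $\mathcal O^{(n)}$ is the set of all functions $X^n\to X$, $\mathcal O=\bigcup_{n\geq 1}\mathcal O^{(n)}$. A clone is a subset of $\mathcal O$ containing all projections and closed under composition; $\langle\mathcal F\rangle$ is the smallest clone containing $\mathcal F$. A function $f\in\mathcal O^{(n)}$ is almost unary if there exist $F\in\mathcal O^{(1)}$ and $1\leq k\leq n$ such that $f(x_1,\ldots,x_n)<F(x_k)$ for all $(x_1,\ldots,x_n)\in X^n$ (here $<$ is the well-order of the cardinal $X$). $\mathcal U$ is the set of all almost unary functions, and $T_1=\mathcal U\cap\mathcal O^{(2)}$. $\mathrm{Pol}(T_1)$ is the set of all $f\in\mathcal O$, say of arity $n$, such that $f(g_1,\ldots,g_n)\in T_1$ for all $g_1,\ldots,g_n\in T_1$. $m^n_k(x_1,\ldots,x_n)$ denotes the $k$-th smallest entry of the tuple, i.e. $m^n_k(x_1,\ldots,x_n)=x_{j_k}$ if $x_{j_1}\leq\cdots\leq x_{j_n}$ with $\{j_1,\ldots,j_n\}=\{1,\ldots,n\}$.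 *)

(* Defs.v *)
From mathcomp Require Import all_boot all_order.
From mathcomp Require Import boolp classical_sets functions cardinality.

Set Implicit Arguments.
Unset Strict Implicit.
Unset Printing Implicit Defensive.

Local Open Scope order_scope.
Local Open Scope classical_set_scope.
Local Open Scope card_scope.

(* A cardinal is a well-ordered set that injects into none of its proper
   initial segments; it is regular if each of its cofinal subsets has full
   cardinality. *)
Definition infinite_regular_cardinal (d : Order.disp_t) (X : orderType d)
    : Prop :=
  [/\ well_founded (fun x y : X => x < y),
      infinite_set [set: X],
      forall x : X, ~ ([set: X] #<= [set y : X | y < x])
    & forall A : set X, (forall x : X, exists2 y, A y & x <= y) ->
        [set: X] #<= A].

(* The type also has nullary members; these are excluded by [all_ops]. *)
Definition operation (T : Type) : Type := {n : nat & n.-tuple T -> T}.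

Definition Op (T : Type) (n : nat) (f : n.-tuple T -> T) : operation T :=
  existT (fun n => n.-tuple T -> T) n f.

Definition ops_of_arity (T : Type) (n : nat) : set (operation T) :=
  range (@Op T n).
Arguments ops_of_arity : clear implicits.

Definition all_ops (T : Type) : set (operation T) :=
  \bigcup_(n in [set n : nat | (1 <= n)%N]) ops_of_arity T n.
Arguments all_ops : clear implicits.

Definition projection (T : Type) (n : nat) (i : 'I_n) : n.-tuple T -> T :=
  fun x => tnth x i.

Definition compose (T : Type) (n m : nat) (f : n.-tuple T -> T)
    (g : 'I_n -> m.-tuple T -> T) : m.-tuple T -> T :=
  fun x => f [tuple g i x | i < n].

Definition is_clone (T : Type) (C : set (operation T)) : Prop :=
  [/\ C `<=` all_ops T,
      forall (n : nat) (i : 'I_n), C (Op (@projection T n i))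
    & forall (n m : nat) (f : n.-tuple T -> T) (g : 'I_n -> m.-tuple T -> T),
        C (Op f) -> (forall i, C (Op (g i))) -> C (Op (compose f g))].

Definition generated_clone (T : Type) (F : set (operation T))
    : set (operation T) :=
  smallest (@is_clone T) F.

Section OrderedBase.
Variables (d : Order.disp_t) (X : orderType d).

Definition almost_unary : set (operation X) :=
  [set h | exists (n : nat) (f : n.-tuple X -> X) (F : X -> X) (k : 'I_n),
     h = Op f /\ forall x : n.-tuple X, f x < F (tnth x k)].

Definition T1 : set (operation X) := almost_unary `&` ops_of_arity X 2.

Definition Pol_T1 : set (operation X) :=
  [set h | all_ops X h /\
     exists (n : nat) (f : n.-tuple X -> X), h = Op f /\
       forall g : 'I_n -> 2.-tuple X -> X,
         (forall i, T1 (Op (g i))) -> T1 (Op (compose f g))].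

(* Indices start at 0: this is $m^n_{k+1}$. *)
Definition order_stat (n : nat) (k : 'I_n) : n.-tuple X -> X :=
  fun x => tnth (sort_tuple <=%O x) k.

(* $\langle \{m^n_2\} \cup T_1 \rangle$; for n >= 2 exactly one k : 'I_n
   satisfies k.+1 = 2. *)
Definition M (n : nat) : set (operation X) :=
  generated_clone
    ([set Op (order_stat k) | k in [set k : 'I_n | k.+1 = 2%N]] `|` T1).

End OrderedBase.

Arguments almost_unary {d} X.
Arguments T1 {d} X.
Arguments Pol_T1 {d} X.
Arguments M {d} X n.

(* Main.v *)
Require Import Defs.
From mathcomp Require Import all_boot all_order.
From mathcomp Require Import boolp classical_sets functions cardinality.

(** The clones [M X k.+1] have an intrinsic description, from which the whole
    theorem is read off. Say that a set [A] of variables dominates [f] when [f]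
    is bounded on every set of inputs whose coordinates in [A] are bounded;
    [f] is almost unary exactly when a single variable dominates it. For
    [k >= 1], an operation belongs to [M X k.+1] if and only if every colouring
    of its variables by [k] colours has a colour class that dominates it
    ([M_colour_dominated]).

    From left to right: the operations with the colouring property form a
    clone, because a colouring of the variables of the inner operations induces
    one of the variables of the outer operation. It contains the almost unary
    operations, and it contains the second smallest of [k.+1] entries since two
    of the [k.+1] variables share a colour.

    From right to left: let [f] have the colouring property, and let [Ds] be
    the family of the sets [D] whose complement does not dominate [f]. A
    colouring that avoids the sets [D_1, ..., D_k] (each variable receives the
    index of a set that it is not in) would have no dominating class, so any
    [k] members of [Ds] have a common element. This is the condition under
    which second smallest entries and projections alone compose to a term [t]
    whose value is, for every [D] in [Ds], at least the minimum of the entries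
    indexed by [D] ([common_upper_term]). Then for every input [x] the
    variables with value at most [t x] form a dominating set: otherwise their
    complement would be in [Ds] and contain a variable with value at most
    [t x]. As there are finitely many sets of variables, [f x] is bounded by a
    function of [t x] alone. Hence [f] is an almost unary operation applied to
    [t] and the projections, and every almost unary operation, of any arity,
    is a composition of binary ones ([clone_almost_unary]).

    The consequences: every operation is dominated by the set of all its
    variables, by regularity, so one colour gives all operations; for two
    colours the property is that of [Pol_T1]; the second smallest of [k.+1]
    entries has the property for [k] colours but not for [k.+1], as no single
    variable dominates it; and an operation that has the property for as many
    colours as it has variables is dominated by a single variable. *)

Set Implicit Arguments.
Unset Strict Implicit.
Unset Printing Implicit Defensive.

Import Order.TTheory.

Local Open Scope classical_set_scope.

(** * Boundedness in regular cardinals *)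

Section RegularCardinal.
Local Open Scope order_scope.
Local Open Scope card_scope.

Context (d : Order.disp_t) (X : orderType d).
Hypothesis hX : infinite_regular_cardinal X.

Lemma X_inhabited : exists x : X, True.
Proof.
case: hX => _ inf _ _; case/infinite_setN0: inf => x _; by exists x.
Qed.

(** A greatest element would be a one-element cofinal set, which by regularity
    would have the cardinality of the infinite [X]. *)
Lemma exists_gt (x : X) : exists y, x < y.
Proof.
case: hX => _ inf _ reg; apply: contrapT => /forallNP maxx.
apply: inf; apply: card_le_finite (finite_set1 x).
apply: reg => y; exists x => //; rewrite leNgt; apply/negP; exact: maxx.
Qed.

Lemma exists_gt2 (x y : X) : exists2 z, x < z & y < z.
Proof.
have [z] := exists_gt (Order.max x y).
by rewrite gt_max => /andP[]; exists z.
Qed.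

(** Otherwise the image would be cofinal, hence as large as [X], although it is
    the image of an initial segment. *)
Lemma image_le_bounded (f : X -> X) (a : X) :
  exists b, forall z, z <= a -> f z < b.
Proof.
case: hX => _ _ small reg; apply: contrapT => /forallNP unb.
have [a' aa'] := exists_gt a.
apply: (small a'); apply: (@card_le_trans _ _ _ (f @` [set z | z <= a])).
  apply: reg => b; apply: contrapT => nob; apply: (unb b) => z za.
  rewrite ltNge; apply/negP => bfz.
  by apply: nob; exists (f z) => //; exists z.
apply: card_le_trans (card_image_le _ _) (subset_card_le _).
by move=> z /= /le_lt_trans; apply.
Qed.

Lemma fin_bounded (I : finType) (f : I -> X) : exists b, forall i, f i < b.
Proof.
have [x0 _] := X_inhabited.
have [b mb] := exists_gt (\big[Order.max/x0]_i f i).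
by exists b => i; apply: le_lt_trans mb; exact: le_bigmax.
Qed.

(** A box is no initial segment, but regularity applies to one coordinate at a
    time. *)
Lemma seq_box_bounded (n : nat) (f : seq X -> X) (a : X) :
  exists b, forall s, size s = n -> all (<= a) s -> f s < b.
Proof.
elim: n f => [|n IH] f.
  by have [b fb] := exists_gt (f [::]); exists b => -[].
have /choice[g gP] z := IH (fun s => f (z :: s)).
have [b gb] := image_le_bounded g a.
exists b => -[//|z s] [sn] /= /andP[za sa].
by apply: lt_trans (gb _ za); exact: gP.
Qed.

Lemma exists_bottom : exists o : X, forall x, o <= x.
Proof.
case: hX => wf _ _ _; apply: contrapT => /forallNP nobot.
have [x0 _] := X_inhabited.
elim/(well_founded_ind wf): x0 => x IH.
apply: (nobot x) => y; rewrite leNgt; apply/negP => yx; exact: IH yx.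
Qed.

(** A final segment is cofinal, so by regularity it is as large as [X]. *)
Lemma injection_above (s : X) :
  exists2 e : X -> X, injective e & forall z, s < e z.
Proof.
case: hX => _ _ _ reg.
have /card_leP[e] : [set: X] #<= [set x | s < x].
  apply: reg => x; have [y sy xy] := exists_gt2 s x.
  by exists y => //; exact: ltW.
have mT x : x \in [set: X] by rewrite inE.
exists (fun z => val (e (SigSub (mT z)))).
  move=> z z' /val_inj /(@inj _ _ _ e); rewrite !inE => /(_ I I).
  by move=> /(congr1 val).
by move=> z; have := set_valP (e (SigSub (mT z))).
Qed.

Lemma wf_dependent_choice
    (P : forall y : X, (forall y', y' < y -> X) -> X -> Prop) :
  (forall y r, exists x, P y r x) ->
  exists s : X -> X, forall y, P y (fun y' _ => s y') (s y).
Proof.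
case: hX => wf _ _ _ exP.
pose step y r := sval (cid (exP y r)).
exists (Fix wf (fun _ => X) step) => y.
rewrite Fix_eq; first exact: (svalP (cid (exP y _))).
move=> x f g fg; congr step; apply: functional_extensionality_dep => y'.
by apply: functional_extensionality_dep => p; exact: fg.
Qed.

(** The codes [p y z] with first coordinate [y] are placed above a point [s y]
    which is above all codes in use for smaller first coordinates; such a point
    exists because only [z <= h y'] count, so that regularity bounds them. The
    value [o] lies outside the range of [p] and serves to say that nothing is
    encoded. The bound [h] is the identity to encode pairs in weakly
    decreasing order, and a bound of an almost unary operation to store its
    values. *)
Lemma bounded_pairing (h : X -> X) :
  exists (o : X) (p : X -> X -> X) (dec : X -> X * X),
    (forall y z, p y z != o) /\ (forall y z, z <= h y -> dec (p y z) = (y, z)).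
Proof.
have [o obot] := exists_bottom.
have /choice[e eP] s : exists e : X -> X, injective e /\ forall z, s < e z.
  by have [e ei es] := injection_above s; exists e.
have [s sP] : exists s : X -> X, forall y y' z, y' < y -> z <= h y' ->
    e (s y') z < s y.
  pose P y (r : forall y', y' < y -> X) x :=
    forall y' (y'y : y' < y) z, z <= h y' -> e (r y' y'y) z < x.
  have [y r|s sP] := @wf_dependent_choice P; last first.
    by exists s => y y' z y'y; exact: (sP y y' y'y).
  have /choice[g gP] y' : exists b, forall (y'y : y' < y) z, z <= h y' ->
      e (r y' y'y) z < b.
    case: (pselect (y' < y)) => [y'y|ny]; last by exists o => y'y.
    have [b hb] := image_le_bounded (e (r y' y'y)) (h y').
    exists b => y'y2; rewrite (Prop_irrelevance y'y2 y'y); exact: hb.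
  have [b gb] := image_le_bounded g y.
  exists b => y' y'y z zh; apply: lt_trans (gP y' y'y z zh) (gb _ (ltW y'y)).
pose p y z := e (s y) z.
have p_inj y z y' z' : z <= h y -> z' <= h y' -> p y z = p y' z' ->
    (y, z) = (y', z').
  move=> zh zh' pp; case: (ltgtP y y') => [yy'|yy'|yy'].
  - have := lt_trans (sP _ _ _ yy' zh) ((eP (s y')).2 z').
    by rewrite -/(p _ _) -/(p _ _) pp ltxx.
  - have := lt_trans (sP _ _ _ yy' zh') ((eP (s y)).2 z).
    by rewrite -/(p _ _) -/(p _ _) pp ltxx.
  - by move: pp; rewrite yy' /p => /(eP (s y')).1 ->.
have /choice[dec decP] u : exists yz : X * X,
    forall y z, z <= h y -> p y z = u -> yz = (y, z).
  case: (pselect (exists yz : X * X, yz.2 <= h yz.1 /\ p yz.1 yz.2 = u)).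
    move=> [[y z] /= [zh pu]]; exists (y, z) => y' z' zh' pu'.
    by apply: p_inj => //; rewrite pu.
  by move=> no; exists (o, o) => y z zh pu; case: no; exists (y, z).
exists o, p, dec; split=> [y z|y z zh]; last exact: decP.
by rewrite gt_eqF // (le_lt_trans (obot (s y))) // (eP (s y)).2.
Qed.

End RegularCardinal.

(** * Order statistics *)

Section OrderStatistics.
Local Open Scope order_scope.
Context (d : Order.disp_t) (X : orderType d).

(** In a sorted sequence the elements of a down-closed set come first. *)
Lemma nth_sorted_down (P : pred X) (x0 : X) (s : seq X) (k : nat) :
  (forall u v, u <= v -> P v -> P u) -> sorted <=%O s -> (k < size s)%N ->
  P (nth x0 s k) = (k < count P s)%N.
Proof.
move=> dP; elim: s k => [//|a s IH] k /= srt ks.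
have s_srt : sorted <=%O s by apply: path_sorted srt.
case: (boolP (P a)) => [Pa|nPa] /=.
  by case: k ks => [|k] ks //=; rewrite add1n ltnS IH.
have nPs : {in s, forall x, ~~ P x}.
  move=> x xs; apply: contra nPa; apply: dP.
  by move: srt; rewrite (path_sortedE le_trans) => /andP[/allP/(_ x xs)].
have -> : count P s = 0%N.
  by apply/eqP; rewrite -leqn0 leqNgt -has_count; apply/hasPn.
case: k ks => [|k] ks /=; first exact: negbTE.
by apply: negbTE; apply: nPs; exact: mem_nth.
Qed.

(** Lower and upper bounds of an order statistic both follow from this count,
    with [P] a down-closed set or the complement of an up-closed one. *)
Lemma order_stat_down (P : pred X) (n : nat) (k : 'I_n) (y : n.-tuple X) :
  (forall u v, u <= v -> P v -> P u) ->
  P (order_stat k y) = (k < count P y)%N.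
Proof.
move=> dP; have x0 := tnth y k.
rewrite /order_stat (tnth_nth x0) nth_sorted_down //.
- by rewrite /= count_sort.
- exact: sort_le_sorted.
- by rewrite size_sort size_tuple.
Qed.

Lemma count_tuple (P : pred X) (n : nat) (y : n.-tuple X) :
  count P y = #|[pred i | P (tnth y i)]|.
Proof.
by rewrite -(map_tnth_enum y) count_map -sum1_count big_enum_cond sum1_card.
Qed.

Lemma second_smallest_le (n : nat) (k : 'I_n) (y : n.-tuple X) (i j : 'I_n) v :
  k.+1 = 2%N -> i != j -> tnth y i <= v -> tnth y j <= v -> order_stat k y <= v.
Proof.
move=> [k1] ij yi yj; have /= -> := @order_stat_down (<= v) n k y; last first.
  by move=> a b ab; exact: le_trans.
by rewrite k1 count_tuple; apply/card_gt1P; exists i, j.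
Qed.

(** At most one entry is outside [P], and it can only be the smallest one. *)
Lemma second_smallest_up (P : pred X) (n : nat) (k : 'I_n) (y : n.-tuple X)
    (j : 'I_n) :
  k.+1 = 2%N -> (forall u v, u <= v -> P u -> P v) ->
  (forall i, i != j -> P (tnth y i)) -> P (order_stat k y).
Proof.
move=> [k1] uP Py; apply: negbNE.
have /= -> := @order_stat_down (fun u => ~~ P u) n k y; last first.
  by move=> a b ab; apply: contra; exact: uP.
rewrite k1 -leqNgt count_tuple -(card1 j); apply: subset_leq_card.
by apply/fintype.subsetP => i; rewrite !inE; apply: contraR => /Py ->.
Qed.

End OrderStatistics.

(** * Dominating sets of variables *)

Section Domination.
Local Open Scope order_scope.
Context (d : Order.disp_t) (X : orderType d).
Hypothesis hX : infinite_regular_cardinal X.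

(** Stated with one bound [a] on all entries rather than with their maximum, so
    that the empty set needs no convention: it dominates exactly the bounded
    operations. *)
Definition dominated (n : nat) (f : n.-tuple X -> X) (A : {pred 'I_n}) : Prop :=
  forall a, exists b, forall x,
    (forall i, i \in A -> tnth x i <= a) -> f x < b.

(** Phrased with projections of the dependent pair, so that membership of [Op f]
    unfolds to a statement on [f] itself. *)
Definition colour_dominated (k : nat) : set (operation X) :=
  [set h | (0 < projT1 h)%N /\
    forall c : 'I_(projT1 h) -> 'I_k,
      exists j, dominated (projT2 h) [pred i | c i == j]].

Lemma dominatedW (n : nat) (f : n.-tuple X -> X) (A B : {pred 'I_n}) :
  {subset A <= B} -> dominated f A -> dominated f B.
Proof.
move=> AB domA a; have [b fb] := domA a.
by exists b => x xB; apply: fb => i /AB; exact: xB.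
Qed.

(** The finitely many bounds of the inner operations have a common one. *)
Lemma dominated_compose (n m : nat) (f : n.-tuple X -> X)
    (g : 'I_n -> m.-tuple X -> X) (A : {pred 'I_n}) (B : {pred 'I_m}) :
  dominated f A -> (forall i, i \in A -> dominated (g i) B) ->
  dominated (compose f g) B.
Proof.
move=> domf domg a.
have /choice[b bP] i : exists b, i \in A -> forall x,
    (forall l, l \in B -> tnth x l <= a) -> g i x < b.
  by case: (boolP (i \in A)) => [/domg/(_ a)[b gb]|_]; [exists b|exists a].
have [b' bb'] := fin_bounded hX b.
have [b'' fb] := domf b'.
exists b'' => x xB; apply: fb => i iA; rewrite tnth_mktuple.
by apply: ltW; apply: lt_trans (bb' i); exact: bP.
Qed.

Lemma almost_unary_dominated (h : operation X) :
  almost_unary X h -> exists k, dominated (projT2 h) (pred1 k).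
Proof.
case=> n [f [F [k [-> fF]]]] /=; exists k => a.
have [b Fb] := image_le_bounded hX F a.
by exists b => x xa; apply: lt_trans (fF x) (Fb _ (xa k _)); rewrite inE.
Qed.

Lemma dominated_almost_unary (n : nat) (f : n.-tuple X -> X) (k : 'I_n) :
  dominated f (pred1 k) -> almost_unary X (Op f).
Proof.
move=> /choice[F FP]; exists n, f, F, k; split=> // x; apply: FP => i.
by rewrite inE => /eqP ->.
Qed.

Lemma all_ops_dominated (n : nat) (f : n.-tuple X -> X) : dominated f predT.
Proof.
move=> a; have [x0 _] := X_inhabited hX.
have [b fb] := seq_box_bounded hX n (fun s => oapp f x0 (insub s)) a.
exists b => x xa; have := fb x (size_tuple x); rewrite valK /=; apply.
by apply/all_tnthP => i; exact: xa.
Qed.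

(** For a composition [compose f g], colour the variable [i] of [f] with a
    colour whose class dominates [g i]; the colour of a class that dominates
    [f] then has a class dominating the composition. *)
Lemma colour_dominated_clone (k : nat) : is_clone (colour_dominated k).
Proof.
split.
- by move=> [n f] [/= n0 _]; exists n => //; exists f.
- move=> n i; split=> /=; first by case: i => i; case: n.
  move=> c; exists (c i) => a; have [b ab] := exists_gt hX a.
  by exists b => x xa; apply: le_lt_trans ab; apply: xa; rewrite inE.
- move=> n m f g [/= n0 Cf] Cg; split=> /=.
    by have [] := Cg (Ordinal n0).
  move=> c; have /choice[c' c'P] i := (Cg i).2 c.
  have [j domf] := Cf c'; exists j.
  by apply: dominated_compose domf _ => i; rewrite inE => /eqP <-; exact: c'P.
Qed.

Lemma almost_unary_colour_dominated (k : nat) :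
  almost_unary X `<=` colour_dominated k.
Proof.
move=> h /almost_unary_dominated[l doml]; split.
  exact: leq_ltn_trans (leq0n l) (ltn_ord l).
by move=> c; exists (c l); apply: dominatedW doml => i; rewrite !inE => /eqP ->.
Qed.

(** Two of the [k.+1] variables have the same colour, and the second smallest
    entry is at most the larger of these two. *)
Lemma second_smallest_colour_dominated (k : nat) (i : 'I_k.+1) :
  i.+1 = 2%N -> colour_dominated k (Op (order_stat i : k.+1.-tuple X -> X)).
Proof.
move=> i1; split=> //= c.
have /injectivePn[p [q pq cpq]] : ~~ injectiveb c.
  apply/injectiveP => /leq_card; by rewrite !card_ord ltnn.
exists (c p) => a; have [b ab] := exists_gt hX a.
exists b => x xa; apply: le_lt_trans ab.
by apply: (second_smallest_le i1 pq); apply: xa; rewrite inE // cpq.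
Qed.

(** When all variables have different colours, a class is a single variable;
    keep it fixed and let all the other entries grow together. *)
Lemma second_smallest_not_colour_dominated (k : nat) (i : 'I_k) :
  i.+1 = 2%N -> ~ colour_dominated k (Op (order_stat i : k.-tuple X -> X)).
Proof.
move=> i1 [/= _ /(_ id)[j dom]].
have [x0 _] := X_inhabited hX; have [b stat_b] := dom x0.
pose y := [tuple if l == j then x0 else b | l < k].
have : order_stat i y < b.
  by apply: stat_b => l; rewrite inE => /eqP ->; rewrite tnth_mktuple eqxx.
rewrite ltNge (second_smallest_up (P := >= b) (j := j)) //.
  by move=> u v uv bu; exact: le_trans uv.
by move=> l lj; rewrite tnth_mktuple (negbTE lj).
Qed.

(** Add a colour that is not used. The class found may be the one of that
    colour; it is empty, so that every class dominates. *)
Lemma colour_dominated_decr (k : nat) :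
  (0 < k)%N -> colour_dominated k.+1 `<=` colour_dominated k.
Proof.
move=> k0 [n f] [/= n0 dom]; split=> // c.
have [j domj] := dom (fun i => widen_ord (leqnSn k) (c i)).
case: (pselect (exists i, widen_ord (leqnSn k) (c i) = j)) => [[i ij]|no].
  exists (c i); apply: dominatedW domj => l.
  by rewrite !inE -ij => /eqP/(congr1 val) /= /val_inj ->.
exists (Ordinal k0); apply: dominatedW domj => l; rewrite !inE => /eqP lj.
by case: no; exists l.
Qed.

Lemma colour_dominated1 : all_ops X = colour_dominated 1.
Proof.
apply/seteqP; split; last by have [] := colour_dominated_clone 1.
move=> _ [n n0 [f _ <-]]; split=> //= c; exists ord0.
by apply: dominatedW (all_ops_dominated f) => i _; rewrite inE ord1.
Qed.

End Domination.

(** * Almost unary operations from binary ones *)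

Section ClonesAboveT1.
Local Open Scope order_scope.
Context (d : Order.disp_t) (X : orderType d).
Hypothesis hX : infinite_regular_cardinal X.
Context (C : set (operation X)).
Hypotheses (C_clone : is_clone C) (T1C : T1 X `<=` C).

Lemma clone_T1_compose (m : nat) (phi : X -> X -> X) (F : X -> X)
    (a b : m.-tuple X -> X) :
  (forall y z, phi y z < F y) -> C (Op a) -> C (Op b) ->
  C (Op (fun x => phi (a x) (b x))).
Proof.
move=> phiF Ca Cb; case: C_clone => _ _ Ccomp.
pose g (y : 2.-tuple X) := phi (tnth y ord0) (tnth y ord_max).
have Cg : C (Op g).
  apply: T1C; split; last by exists g.
  by exists 2, g, F, ord0; split=> // x; exact: phiF.
have := Ccomp _ m _ (fun i => if i == ord0 then a else b) Cg.
rewrite /compose /g; under eq_fun do rewrite !tnth_mktuple /=.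
by apply=> i; case: ifP.
Qed.

(** An almost unary operation of any arity is given by a function [phi] of its
    dominating argument [t] and the list [l] of the others. If [l] has two
    entries or more, its first two, [y] and [z], are replaced by one. The pair
    cannot be encoded by an operation in the clone of almost unary ones, but a
    binary almost unary operation encodes it when [z <= y] and yields [o]
    otherwise, and another one does so when [y < z]. The value of [phi] in the
    first case is computed first and passed on, encoded with [t], in place of
    [t]; it is below [F t], so that this operation is almost unary as well. The
    second case is decided afterwards. *)
Lemma clone_almost_unary (m : nat) (phi : X -> seq X -> X) (F : X -> X)
    (a : m.-tuple X -> X) (gs : seq (m.-tuple X -> X)) :
  (forall t l, phi t l < F t) -> C (Op a) ->
  (forall n, (n < size gs)%N -> C (Op (nth a gs n))) ->
  C (Op (fun x => phi (a x) [seq g x | g <- gs])).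
Proof.
have [N] := ubnP (size gs); elim: N phi F a gs => // N IH phi F a gs.
case: gs => [|b [|c gs]] /= gsN phiF Ca Cgs.
- exact: (@clone_T1_compose m (fun y _ => phi y [::]) F a a).
- apply: (@clone_T1_compose m (fun y z => phi y [:: z]) F a b) => //.
  exact: (Cgs 0).
have Cb : C (Op b) := Cgs 0 isT.
have Cc : C (Op c) := Cgs 1%N isT.
have Cg n : (n < size gs)%N -> C (Op (nth a gs n)) by exact: (Cgs n.+2).
have [o [p [dec [p_neq_o decK]]]] := bounded_pairing hX id.
have [o' [p' [dec' [_ dec'K]]]] := bounded_pairing hX F.
have [B pB] : exists B, forall y, o < B y /\ forall z, z <= y -> p y z < B y.
  have /choice[B BP] y := image_le_bounded hX (p y) y.
  have /choice[B' B'P] y : exists b, o < b /\ forall z, z <= y -> p y z < b.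
    have [s Bs os] := exists_gt2 hX (B y) o.
    by exists s; split=> // z zy; apply: lt_trans Bs; exact: BP.
  by exists B'.
pose u x := if c x <= b x then p (b x) (c x) else o.
pose v x := if c x <= b x then o else p (c x) (b x).
have Cu : C (Op u).
  apply: (clone_T1_compose (phi := fun y z => if z <= y then p y z else o)
    (F := B)) Cb Cc => y z; case: (pB y) => oB pyB.
  by case: (leP z y) => // zy; exact: pyB.
have Cv : C (Op v).
  apply: (clone_T1_compose (phi := fun y z => if y <= z then o else p y z)
    (F := B)) Cc Cb => y z; case: (pB y) => oB pyB.
  by case: (leP y z) => // zy; exact: pyB (ltW zy).
(* If [w] is [o], then [dec w] is arbitrary, but the value of [phi] stored here
   is then ignored by [phi2], whose own [w] is not [o]. *)
pose phi1 t l := if l is w :: l' then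
  p' t (phi t [:: (dec w).1, (dec w).2 & l']) else t.
pose phi2 t l := if l is w :: l' then
  if w == o then (dec' t).2
  else phi (dec' t).1 [:: (dec w).2, (dec w).1 & l'] else t.
have [F1 phi1F] : exists F1, forall t l, phi1 t l < F1 t.
  have /choice[F1 F1P] t : exists b, forall l, phi1 t l < b.
    have [s ps] := image_le_bounded hX (p' t) (F t).
    have [s' ss' ts'] := exists_gt2 hX s t.
    exists s' => -[|w l] //=; apply: lt_trans ss'; apply: ps; exact: ltW.
  by exists F1.
have [F2 phi2F] : exists F2, forall t l, phi2 t l < F2 t.
  have /choice[F2 F2P] t : exists b, forall l, phi2 t l < b.
    have [s ts ds] := exists_gt2 hX t (dec' t).2.
    have [s' ss' Fs'] := exists_gt2 hX s (F (dec' t).1).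
    exists s' => -[|w l] /=; first exact: lt_trans ss'.
    case: ifP => _; first exact: lt_trans ss'.
    exact: lt_trans Fs'.
  by exists F2.
pose a1 x := phi1 (a x) [seq g x | g <- u :: gs].
have Ca1 : C (Op a1) by apply: (IH _ F1) => // -[|n] //=; exact: Cg.
have : C (Op (fun x => phi2 (a1 x) [seq g x | g <- v :: gs])).
  apply: (IH _ F2) => // -[|n] //= ngs.
  by rewrite (set_nth_default a) //; exact: Cg.
congr (C (Op _)); apply: funext => x.
rewrite /a1 /= /v /u dec'K; last exact: ltW.
case: (leP (c x) (b x)) => [cb|bc] /=; first by rewrite eqxx decK.
by rewrite (negbTE (p_neq_o _ _)) decK //= ltW.
Qed.

End ClonesAboveT1.

(** * Composing operations from second smallest entries *)

Section SecondSmallestGenerates.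
Local Open Scope order_scope.
Context (d : Order.disp_t) (X : orderType d).
Hypothesis hX : infinite_regular_cardinal X.
Context (k : nat) (i0 : 'I_k.+1) (C : set (operation X)).
Hypotheses (i0_second : i0.+1 = 2%N) (C_clone : is_clone C) (T1C : T1 X `<=` C).
Hypothesis stat_C : C (Op (order_stat i0 : k.+1.-tuple X -> X)).

(** The conclusion on [D] says that [t x] is at least the minimum of the entries
    of [x] indexed by [D]. The proof is by induction on the size of [Ds]. Up to
    [k] sets have a common element, and the projection to it is such a term.
    With more sets, choose [k.+1] of them and take the second smallest of the
    terms for [Ds] with one of these sets left out: a given [D] is missing from
    at most one of these families, so all but one of the terms are large enough
    for [D]. *)
Lemma common_upper_term (n : nat) (Ds : seq {set 'I_n}) :
  (0 < n)%N ->
  (forall D : 'I_k -> {set 'I_n}, (forall j, D j \in Ds) ->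
     exists i, forall j, i \in D j) ->
  exists t : n.-tuple X -> X, C (Op t) /\
    forall D x, D \in Ds -> exists2 i, i \in D & tnth x i <= t x.
Proof.
move=> n0; have [N] := ubnP (size Ds); elim: N Ds => // N IH Ds DsN Dsk.
have Cproj i : C (Op (@projection X n i)) by case: C_clone.
have [Ds0|Ds_gt0] := posnP (size Ds).
  by exists (projection (Ordinal n0)); split=> // D x; rewrite (size0nil Ds0).
have [Ds_k|k_Ds] := leqP (size Ds) k.
  (* If [Ds] has fewer than [k] members, repeat the first one. *)
  pose D0 := head finset.set0 Ds.
  have [j|i iP] := Dsk (fun j => nth D0 Ds j).
    have [jDs|Dsj] := ltnP j (size Ds); first exact: mem_nth.
    by rewrite nth_default // /D0 -nth0 mem_nth.
  exists (projection i); split=> // D x /(nthP D0)[j jDs <-].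
  by exists i => //; exact: (iP (Ordinal (leq_trans jDs Ds_k))).
pose Dsj j := take j Ds ++ drop j.+1 Ds.
have Dsj_sub j : {subset Dsj j <= Ds}.
  by move=> D; rewrite mem_cat => /orP[/mem_take|/mem_drop].
have /choice[t tP] (j : 'I_k.+1) : exists t : n.-tuple X -> X, C (Op t) /\
    forall D x, D \in Dsj j -> exists2 i, i \in D & tnth x i <= t x.
  have jDs : (j < size Ds)%N := leq_ltn_trans (leq_ord j) k_Ds.
  apply: IH => [|D DDs]; last by apply: Dsk => l; exact: Dsj_sub.
  rewrite size_cat size_drop size_takel; last exact: ltnW.
  by move: DsN; rewrite -[in X in X -> _](subnKC jDs) addSn ltnS.
exists (compose (order_stat i0) t); split.
  by case: C_clone => _ _; apply => // j; exact: (tP j).1.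
move=> D x DDs.
pose P v := [exists i in D, tnth x i <= v].
suff /exists_inP[i iD xi] : P (compose (order_stat i0) t x) by exists i.
have uP u v : u <= v -> P u -> P v.
  move=> uv /exists_inP[i iD xi]; apply/exists_inP; exists i => //.
  exact: le_trans uv.
have tjP (j : 'I_k.+1) : D \in Dsj j -> P (t j x).
  by move=> /(tP j).2-/(_ x)[i iD xi]; apply/exists_inP; exists i.
(* Only the term that leaves out the first occurrence of [D] may be too small
   for [D]. If the index of that occurrence exceeds [k], no term leaves it out,
   and the last term is taken as the exceptional one. *)
have l_k : (minn (index D Ds) k < k.+1)%N by rewrite ltnS geq_minr.
apply: (@second_smallest_up _ _ P _ i0 _ (Ordinal l_k)) => // j jl.
rewrite tnth_mktuple; apply: tjP; rewrite mem_cat.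
have : D \in take j Ds ++ drop j Ds by rewrite cat_take_drop.
rewrite mem_cat; case: (D \in take j Ds) / boolP => //= Dtake.
have jDs : (j < size Ds)%N := leq_ltn_trans (leq_ord j) k_Ds.
rewrite (drop_nth D) // inE => /orP[/eqP Dj|//].
move: jl; rewrite -val_eqE /= => /negP[]; apply/eqP.
have idx : index D Ds = j.
  rewrite -(cat_take_drop j Ds) index_cat (negbTE Dtake) (drop_nth D) //.
  by rewrite -Dj /= eqxx addn0 size_takel // ltnW.
by rewrite idx; apply/esym/minn_idPl; rewrite -ltnS.
Qed.

(** The clone contains a term that bounds the given operation, up to a unary
    function, and any operation so bounded is almost unary in the term. *)
Lemma colour_dominated_sub_clone : colour_dominated k `<=` C.
Proof.
move=> [n f] [/= n0 dom].
pose Ds := enum [set D : {set 'I_n} | `[< ~ dominated f (mem (~: D)) >]]%SET.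
have [||t [Ct tP]] := @common_upper_term n Ds => //.
  move=> D DDs; apply: contrapT => no.
  have /choice[c cP] i : exists j, i \notin D j.
    apply: contrapT => noj; apply: no; exists i => j.
    by apply/negPn/negP => iDj; apply: noj; exists j.
  have [j domj] := dom c.
  move: (DDs j); rewrite mem_enum inE => /asboolP; apply.
  by apply: dominatedW domj => i; rewrite !inE => /eqP <-; exact: cP.
pose below x : {set 'I_n} := [set i | tnth x i <= t x]%SET.
have domt x : dominated f (mem (below x)).
  apply: contrapT => ndom.
  have [|i] := tP (~: below x) x; last by rewrite !inE => /negP.
  by rewrite mem_enum inE; apply/asboolP; rewrite finset.setCK.
have /choice[G GP] a : exists b, forall x, t x = a -> f x < b.
  have /choice[b bP] (A : {set 'I_n}) : exists b, dominated f (mem A) ->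
      forall x, (forall i, i \in A -> tnth x i <= a) -> f x < b.
    case: (pselect (dominated f (mem A))) => [/(_ a)[b fb]|no].
      by exists b.
    by exists a.
  have [b' bb'] := fin_bounded hX b; exists b' => x ta.
  apply: lt_trans (bb' _); apply: (bP _ (domt x)) => i.
  by rewrite inE ta.
have /choice[F FP] a : exists b, a < b /\ G a < b.
  by have [b ab Gb] := exists_gt2 hX a (G a); exists b.
(* The bound [G a] holds for the inputs [x] with [t x = a] only; other lists may
   be sent to [a] itself, which keeps [phi] almost unary. *)
pose phi a l := let y := oapp f a (insub l) in if y < G a then y else a.
have := @clone_almost_unary _ _ hX C C_clone T1C n phi F t
  [seq @projection X n i | i <- enum 'I_n].
have -> : (fun x => phi (t x)
    [seq g x | g <- [seq @projection X n i | i <- enum 'I_n]]) = f.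
  apply: funext => x; rewrite -map_comp /comp /projection map_tnth_enum /phi.
  by rewrite valK /= (GP _ x).
apply=> //.
  move=> a l; rewrite /phi; have [aF GF] := FP a.
  by case: ifP => // yG; exact: lt_trans yG GF.
move=> j; rewrite size_map => jn; rewrite (nth_map (Ordinal n0)) //.
by case: C_clone.
Qed.

End SecondSmallestGenerates.

(** * The chain of clones *)

Section Chain.
Local Open Scope order_scope.
Context (d : Order.disp_t) (X : orderType d).
Hypothesis hX : infinite_regular_cardinal X.

Lemma generated_clone_is_clone (F : set (operation X)) :
  F `<=` all_ops X -> is_clone (generated_clone F).
Proof.
move=> Fall; split.
- apply: smallest_sub Fall; split=> //.
  + move=> n i; exists n; last by exists (projection i).
    by case: i => i /=; exact: leq_ltn_trans.
  + move=> n m f g [n' n'0 [f' _ e]] Cg; exists m; last by exists (compose f g).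
    have n0 : (0 < n)%N by have <- : n' = n := congr1 (@projT1 _ _) e.
    have [m' m'0 [g' _ e']] := Cg (Ordinal n0).
    by have <- : m' = m := congr1 (@projT1 _ _) e'.
- by move=> n i C [[_ Cp _] _]; exact: Cp.
- move=> n m f g Cf Cg C [C_clone FC].
  case: (C_clone) => _ _; apply; first exact: Cf.
  by move=> i; exact: Cg.
Qed.

Lemma M_colour_dominated (k : nat) : (0 < k)%N -> M X k.+1 = colour_dominated k.
Proof.
move=> k0; pose i0 : 'I_k.+1 := Ordinal (k0 : (1 < k.+1)%N).
apply/seteqP; split.
  apply: smallest_sub; first exact: (colour_dominated_clone hX).
  move=> h [[i i1 <-]|[hU _]].
    exact: (second_smallest_colour_dominated hX).
  exact: (almost_unary_colour_dominated hX).
have gen := @sub_gen_smallest _ (@is_clone X)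
  ([set Op (order_stat (X := X) i) | i in [set i : 'I_k.+1 | i.+1 = 2%N]]
   `|` T1 X).
apply: (@colour_dominated_sub_clone _ _ hX k i0) => //.
- apply: generated_clone_is_clone => h [[i i1 <-]|[_ [f _ <-]]].
    by exists k.+1 => //; exists (order_stat i).
  by exists 2 => //; exists f.
- by apply: subset_trans gen; exact: subsetUr.
- by apply: gen; left; exists i0.
Qed.

(** If neither of two complementary classes dominates [f], there are inputs
    [z v] bounded on the first class and inputs [w v] bounded on the second one
    such that [v <= f (z v)] and [v <= f (w v)]. The operations [g i] that run
    through [z v] for first argument [x0] and second argument [v], and through
    [w v] for first argument [v], are almost unary, in the first argument if
    [i] is in the first class and in the second argument otherwise. But
    [compose f g] is unbounded both for first argument [x0] and for second
    argument [x0]. *)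
Lemma Pol_T1_colour_dominated : Pol_T1 X = colour_dominated 2.
Proof.
have [Q_all _ Q_comp] := colour_dominated_clone hX 2.
have sub_U := @almost_unary_colour_dominated _ _ hX 2.
apply/seteqP; split; last first.
  move=> [n f] Qf; split; first exact: Q_all.
  exists n, f; split=> // g T1g.
  have Qfg : colour_dominated 2 (Op (compose f g)).
    by apply: Q_comp => // i; apply: sub_U; have [] := T1g i.
  split; last by exists (compose f g).
  have [_ /(_ id)[j domj]] := Qfg.
  by apply: (@dominated_almost_unary _ _ _ _ j); exact: domj.
move=> h [[n n0 [f0 _ hf0]] [n' [f [hf pol]]]]; rewrite {}hf in hf0 *.
have n'0 : (0 < n')%N by have <- : n = n' := congr1 (@projT1 _ _) hf0.
split=> // c; apply: contrapT => nodom.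
have unb j : exists a, forall v, exists x,
    (forall i, c i = j -> tnth x i <= a) /\ v <= f x.
  apply: contrapT => none; apply: nodom; exists j => a.
  apply: contrapT => nob; apply: none; exists a => v.
  apply: contrapT => nox; apply: nob; exists v => x xa.
  rewrite ltNge; apply/negP => vfx; apply: nox; exists x; split=> // i ij.
  by apply: xa; rewrite inE ij.
have [a0 /choice[z zP]] := unb ord0.
have [a1 /choice[w wP]] := unb ord_max.
have [x0 _] := X_inhabited hX.
pose g i (y : 2.-tuple X) :=
  if tnth y ord0 == x0 then tnth (z (tnth y ord_max)) i
  else tnth (w (tnth y ord0)) i.
have [i|[n2 [fg [F [j [fgE fgF]]]]] _] := pol g.
  split; last by exists (g i).
  have [ci0|ci1] : c i = ord0 \/ c i = ord_max.
    by case: (c i) => -[|[|//]] ij; [left|right]; apply: val_inj.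
  - have /choice[F FP] s : exists b, a0 < b /\ tnth (w s) i < b.
      by have [b a0b wb] := exists_gt2 hX a0 (tnth (w s) i); exists b.
    exists 2, (g i), F, ord0; split=> // y; rewrite /g.
    have [a0F wF] := FP (tnth y ord0); case: ifP => // _.
    by apply: le_lt_trans a0F; exact: (zP _).1.
  - have /choice[F FP] s : exists b, a1 < b /\ tnth (z s) i < b.
      by have [b a1b zb] := exists_gt2 hX a1 (tnth (z s) i); exists b.
    exists 2, (g i), F, ord_max; split=> // y; rewrite /g.
    have [a1F zF] := FP (tnth y ord_max); case: ifP => // _.
    by apply: le_lt_trans a1F; exact: (wP _).1.
have [k domk] : exists k : 'I_2, dominated (compose f g) (pred1 k).
  apply: (@almost_unary_dominated _ _ hX (Op (compose f g))).
  by exists n2, fg, F, j.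
have [b fgb] := domk x0; have [s x0s bs] := exists_gt2 hX x0 b.
have fg_val (y : 2.-tuple X) : compose f g y =
  if tnth y ord0 == x0 then f (z (tnth y ord_max)) else f (w (tnth y ord0)).
  rewrite /compose /g; case: ifP => _; congr f; apply: eq_from_tnth => i;
  by rewrite tnth_mktuple.
have [k0|k1] : k = ord0 \/ k = ord_max.
  by case: (k) => -[|[|//]] ij; [left|right]; apply: val_inj.
- have /fgb : forall i, i \in pred1 k -> tnth [tuple x0; s] i <= x0.
    by move=> i; rewrite k0 inE => /eqP ->.
  rewrite fg_val !(tnth_nth x0) /= eqxx ltNge => /negP[].
  apply: le_trans (ltW bs) _; exact: (zP _).2.
- have /fgb : forall i, i \in pred1 k -> tnth [tuple s; x0] i <= x0.
    by move=> i; rewrite k1 inE => /eqP ->.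
  rewrite fg_val !(tnth_nth x0) /= gt_eqF // ltNge => /negP[].
  apply: le_trans (ltW bs) _; exact: (wP _).2.
Qed.

Lemma colour_dominated_proper (k : nat) :
  (0 < k)%N -> colour_dominated k.+1 `<` colour_dominated (X := X) k.
Proof.
move=> k0; split; first exact: colour_dominated_decr.
pose i0 : 'I_k.+1 := Ordinal (k0 : (1 < k.+1)%N).
move=> /(_ _ (second_smallest_colour_dominated hX (i := i0) erefl)).
exact: (second_smallest_not_colour_dominated hX).
Qed.

Lemma bigcap_colour_dominated :
  \bigcap_(k in [set k | (0 < k)%N]) colour_dominated k = almost_unary X.
Proof.
apply/seteqP; split; last first.
  by move=> h hU k _; exact: (almost_unary_colour_dominated hX).
move=> [n f] Qf; have [/= n0 _] := Qf 1 isT.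
have [_ /(_ id)[j]] := Qf n n0.
exact: dominated_almost_unary.
Qed.

End Chain.

Theorem theorem54 (d : Order.disp_t) (X : orderType d)
    (hX : infinite_regular_cardinal X) :
  [/\ all_ops X = M X 2,
      M X 3 = Pol_T1 X,
      forall n : nat, (2 <= n)%N -> M X n.+1 `<` M X n
    & \bigcap_(n in [set n : nat | (2 <= n)%N]) M X n = almost_unary X].
Proof.
split.
- by rewrite M_colour_dominated // (colour_dominated1 hX).
- by rewrite M_colour_dominated // (Pol_T1_colour_dominated hX).
- case=> // k k0; rewrite !M_colour_dominated //.
  exact: colour_dominated_proper.
- rewrite -(bigcap_colour_dominated hX); apply/seteqP; split=> h hM.
    by move=> k k0; rewrite -M_colour_dominated //; exact: hM.
  by case=> // k k0; rewrite M_colour_dominated //; exact: hM.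
Qed.
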